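(* Let $K$ be a field of characteristic zero, let $L$ be a linear functional on $K[x]$ with moments $\mu_n=L(x^n)$ and $\mu_0=1$, and let $\big(p_n(x)\big)_{n\ge0}$ be a sequence of monic polynomials over $K$ with $\deg p_n(x)=n$, orthogonal with respect to $L$, i.e., $L(p_m(x)p_n(x))=\omega_n\delta_{m,n}$ with $\omega_n\ne0$ for all $n$. Let $(s_n)_{n\ge0}$ and $(t_n)_{n\ge0}$ be the sequences in $K$, with $t_n\neq 0$ for all $n$, such that $$p_n(x)=(x-s_{n-1})p_{n-1}(x)-t_{n-2}p_{n-2}(x),\quad n\ge1,\qquad p_{-1}(x)=0,\ p_0(x)=1.$$ Assume that there are $s,t\in K$ such that $s_i=s$ and $t_i=t$ for all $i\ge1$. Let $d\ge1$ be an integer, let $\lambda_0,\dots,\lambda_{d-1}\in K$, and let $\lambda_d=1$. Put $$ H_n=t_0^{-(n-1)}\,t^{-\binom {n-1}2}\det_{0\le i,j\le n-1}\Bigg(\sum _{k=0} ^{d}\lambda_k\mu_{i+j+k}\Bigg). $$ Then the sequence $(H_n)_{n\ge0}$ satisfies a linear recurrence of the form $$\sum_{i=0}^{2^d}c_iH_{n-i}=0,\quad \text{for }n> 2^d,$$ for some constants $c_i\in K$, normalised by $c_0=1$. Explicitly, these constants can be computed as the coefficients of the characteristic polynomial (in $x$) $\sum_{i=0}^{2^d}c_ix^{2^d-i}$ of the tensor product of $2\times2$ matrices $$ \begin{pmatrix} x_1+s&t\\-1&0\end{pmatrix}\otimes\begin{pmatrix} x_2+s&t\\-1&0\end{pmatrix}\otimes\dots\otimes\begin{pmatrix}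 x_d+s&t\\-1&0\end{pmatrix}, $$ where $x_1,\dots,x_d$ are elements of an algebraic closure of $K$ such that $\lambda_k=e_{d-k}(x_1,x_2,\dots,x_d)$ for $k=0,1,\dots,d$. In particular, $$c_1=-\sum_{j=0}^d\lambda_js^j$$ and $$c_{2^d-i}=t^{d(2^{d-1}-i)}c_i,\quad \text{for }i=0,1,\dots,2^d.$$
   Context: The elementary symmetric polynomials are $e_k(x_1,\dots,x_d)=\sum_{1\le i_1<i_2<\dots<i_k\le d}x_{i_1}x_{i_2}\cdots x_{i_k}$, with $e_0=1$. Equivalently, $\sum_{j=0}^d\lambda_jx^j=\prod_{i=1}^d(x+x_i)$. The tensor product of matrices is the Kronecker product. The existence of the three-term recurrence for $(p_n(x))_{n\ge0}$ is guaranteed by Favard's theorem; the parameter $t_{-1}$ formally occurring for $n=1$ is irrelevant since $p_{-1}(x)=0$. The determinant of an empty matrix equals $1$. *)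

(* Defs.v *)
From HB Require Import structures.
From mathcomp Require Import all_boot all_order all_algebra.
From mathcomp Require Import mxtens.
From mathcomp Require Import mpoly.

Set Implicit Arguments.
Unset Strict Implicit.
Unset Printing Implicit Defensive.

Import GRing.Theory.
Local Open Scope ring_scope.

Definition moment (K : fieldType) (L : {scalar {poly K}}) (n : nat) : K :=
  L 'X^n.

(* The exponents are integers, and the binomial coefficient (n - 1 choose 2) is
   read as (n - 1)(n - 2)/2 for every n; it equals 1 at n = 0, where the nat
   binomial 'C(n.-1, 2) would give 0. *)
Definition scaled_hankel (K : fieldType) (mu lam : nat -> K) (d : nat)
    (t0 t : K) (n : nat) : K :=
  t0 ^ (- (n%:Z - 1)) * t ^ (- ((n%:Z - 1) * (n%:Z - 2) %/ 2)%Z) *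
  \det (\matrix_(i < n, j < n) \sum_(k < d.+1) lam k * mu (i + j + k)%N).

Definition transfer_mx (R : pzRingType) (x s t : R) : 'M[R]_2 :=
  \matrix_(i < 2, j < 2)
    if i == 0 then (if j == 0 then x + s else t)
    else (if j == 0 then -1 else 0).

(* A 0 *t (A 1 *t ( ... *t A (d-1))); the innermost factor, 1%:M of size 1,
   is neutral, and the cast only identifies 2 * 2 ^ d with 2 ^ d.+1. *)
Fixpoint big_tensmx (R : pzRingType) (d : nat) :
    ('I_d -> 'M[R]_2) -> 'M[R]_(2 ^ d) :=
  match d with
  | 0 => fun _ => 1%:M
  | d'.+1 => fun A =>
      castmx (esym (expnS 2 d'), esym (expnS 2 d'))
        (A ord0 *t big_tensmx (fun i : 'I_d' => A (lift ord0 i)))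
  end.

(* Main.v *)
(** Divide the Hankel determinant of the functional [f |-> L (q f)], where
  [q = prod_l (X + x_l)], by the product of the norms [omega_j].  Christoffel's
  formula turns [H_n] times the Vandermonde determinant of the [- x_l] into
  [(-1)^(nd) det (p_(n+k) (- x_l))].  Each term of this determinant is a product
  over [l] of shifts of the sequences [(-1)^n p_n (- x_l)], which for [n >= 1]
  are governed by the transfer matrices; such a product is therefore an entry
  of a sequence of vectors iterated by their tensor product, and Cayley-Hamilton
  gives the recurrence.  To allow repeated [x_l], and to get the [c_i] in [K],
  the [x_l] are taken to be indeterminates: the coefficients of the characteristic
  polynomial are then symmetric, hence polynomials in the elementary symmetric
  polynomials, and as these are algebraically independent every identity
  specialises to the [lambda_k].  The palindromic relation holds because
  [t M^-1] is conjugate to the transpose of each transfer matrix [M], all by the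
  same matrix. *)

Require Import Defs.
From HB Require Import structures.
From mathcomp Require Import all_boot all_order all_algebra all_fingroup.
From mathcomp Require Import mxtens.
From mathcomp Require Import mpoly.
From mathcomp Require Import ring.

Set Implicit Arguments.
Unset Strict Implicit.
Unset Printing Implicit Defensive.

Import GRing.Theory.
Local Open Scope ring_scope.

(** * Tensor products of 2 x 2 matrices *)

Lemma det_reindex (R : comNzRingType) m n (h : 'I_m -> 'I_n) (A : 'M[R]_n) :
  bijective h -> \det (\matrix_(i, j) A (h i) (h j)) = \det A.
Proof.
move=> bij_h; have /eqP := bij_eq_card bij_h; rewrite !card_ord => /eqP eq_mn.
case: n / eq_mn h A bij_h => h A bij_h.
pose s := perm (bij_inj bij_h).
have -> : \matrix_(i, j) A (h i) (h j) = row_perm s (col_perm s A).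
  by apply/matrixP=> i j; rewrite !mxE !permE.
rewrite row_permE col_permE !det_mulmx !det_perm odd_permV mulrCA.
by rewrite -signr_addb addbb mulr1.
Qed.

Lemma char_poly_reindex (R : comNzRingType) m n (h : 'I_m -> 'I_n)
    (A : 'M[R]_n) (B : 'M[R]_m) :
  bijective h -> (forall i j, B i j = A (h i) (h j)) ->
  char_poly B = char_poly A.
Proof.
move=> bij_h BE; rewrite /char_poly -(det_reindex _ bij_h); congr (\det _).
by apply/matrixP=> i j; rewrite !mxE BE (inj_eq (bij_inj bij_h)).
Qed.

(** The matrix is block diagonal with [m] copies of [B]; the induction splits off the first block,
    [h] identifying [m.+1 * n] with [n + m * n]. *)
Lemma det_tens1mx (R : comNzRingType) m n (B : 'M[R]_n) :
  \det ((1%:M : 'M_m) *t B) = \det B ^+ m.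
Proof.
elim: m => [|m IH]; first by rewrite det_mx00.
pose h := cast_ord (esym (mulSn m n)).
have bij_h : bijective h.
  by exists (cast_ord (mulSn m n)) => i; rewrite /h ?cast_ordK ?cast_ordKV.
have hl i : mxtens_unindex (h (lshift _ i)) = (ord0, i).
  have n_gt0 : (0 < n)%N by apply: leq_ltn_trans (ltn_ord i).
  by congr (_, _); apply: val_inj; rewrite /= ?divn_small ?modn_small.
have hr i : mxtens_unindex (h (rshift _ i))
    = (lift ord0 (mxtens_unindex i).1, (mxtens_unindex i).2).
  have n_gt0 : (0 < n)%N by case: n i {h bij_h hl B IH} => // -[i]; rewrite muln0.
  by congr (_, _); apply: val_inj; rewrite /= ?divnDl ?divnn ?n_gt0 ?modnDl.
rewrite -(det_reindex _ bij_h) exprS -IH -(det_ublock B 0); congr (\det _).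
apply/matrixP=> i j; rewrite mxE -[i]splitK -[j]splitK.
case: (split i) => i' /=; case: (split j) => j' /=;
  rewrite ?block_mxEul ?block_mxEur ?block_mxEdl ?block_mxEdr.
all: by rewrite ?[(_ *t _) _ _]mxE ?hl ?hr !mxE -?val_eqE /= ?mul1r ?mul0r.
Qed.

(** Swapping the two tensor factors permutes rows and columns in the same way. *)
Lemma det_tensmx1 (R : comNzRingType) m n (A : 'M[R]_m) :
  \det (A *t (1%:M : 'M_n)) = \det A ^+ n.
Proof.
rewrite -det_tens1mx.
pose h (k : 'I_(n * m)) : 'I_(m * n) :=
  mxtens_index ((mxtens_unindex k).2, (mxtens_unindex k).1).
have bij_h : bijective h.
  exists (fun k => mxtens_index ((mxtens_unindex k).2, (mxtens_unindex k).1)) => k;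
  by rewrite /h mxtens_indexK -[RHS]mxtens_unindexK; case: (mxtens_unindex k).
rewrite -(det_reindex _ bij_h); congr (\det _); apply/matrixP=> i j.
by rewrite mxE tensmxE [RHS]mxE mulrC.
Qed.

Lemma det_tensmx (R : comNzRingType) m n (A : 'M[R]_m) (B : 'M[R]_n) :
  \det (A *t B) = \det A ^+ n * \det B ^+ m.
Proof. by rewrite tensmx_decr det_mulmx det_tensmx1 det_tens1mx. Qed.

Lemma det_castmx (R : comNzRingType) m n (e : m = n) (A : 'M[R]_m) :
  \det (castmx (e, e) A) = \det A.
Proof. by case: n / e; rewrite castmx_id. Qed.

Lemma det_big_tensmx (R : comNzRingType) d (A : 'I_d -> 'M[R]_2) :
  (0 < d)%N -> \det (big_tensmx A) = (\prod_l \det (A l)) ^+ (2 ^ d.-1).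
Proof.
case: d A => // d A _; elim: d A => [|d IH] A.
  by rewrite det_castmx det_tensmx det1 expr1n mulr1 big_ord1.
rewrite -[big_tensmx A]/(castmx (esym (expnS 2 d.+1), esym (expnS 2 d.+1))
  (A ord0 *t big_tensmx (fun i => A (lift ord0 i)))).
by rewrite det_castmx det_tensmx IH -exprM -expnSr [in RHS]big_ord_recl exprMn.
Qed.

(** Indices become functions from factors to ['I_2], by a bijection independent of the ring and of
    the matrices. Identities for tensor products then reduce to expanding a product of sums. *)
Lemma big_tensmxE d : {e : 'I_(2 ^ d) -> {ffun 'I_d -> 'I_2} | bijective e &
  forall (R : comNzRingType) (A : 'I_d -> 'M[R]_2) i j,
    big_tensmx A i j = \prod_l A l (e i l) (e j l)}.
Proof.
elim: d => [|d [e bij_e eE]].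
  exists (fun=> [ffun=> ord0]) => [|R A i j].
    apply: inj_card_bij => [i j _|]; first by rewrite !ord1.
    by rewrite card_ffun !card_ord.
  by rewrite !ord1 mxE big_ord0.
pose u (k : 'I_(2 ^ d.+1)) := mxtens_unindex (cast_ord (expnS 2 d) k).
exists (fun k =>
    [ffun l => if unlift ord0 l is Some l' then e (u k).2 l' else (u k).1]).
  apply: inj_card_bij => [i j /ffunP eq_ij|]; last by rewrite card_ffun !card_ord.
  have eq1 : (u i).1 = (u j).1 by have := eq_ij ord0; rewrite !ffunE unlift_none.
  have eq2 : (u i).2 = (u j).2.
    apply: (bij_inj bij_e); apply/ffunP=> l.
    by have := eq_ij (lift ord0 l); rewrite !ffunE liftK.
  apply: (@cast_ord_inj _ _ (expnS 2 d)); apply: (can_inj (@mxtens_unindexK _ _)).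
  by rewrite -/(u i) -/(u j) [u i]surjective_pairing eq1 eq2 -surjective_pairing.
move=> R A i j; rewrite [big_tensmx A]/= castmxE !esymK mxE eE big_ord_recl.
rewrite !ffunE unlift_none; congr (_ * _); apply: eq_bigr => l _.
by rewrite !ffunE liftK.
Qed.

Lemma big_tensmx_mul (R : comNzRingType) d (A B : 'I_d -> 'M[R]_2) :
  big_tensmx A *m big_tensmx B = big_tensmx (fun l => A l *m B l).
Proof.
have [e bij_e eE] := big_tensmxE d.
apply/matrixP=> i j; rewrite mxE eE.
rewrite (eq_bigr (fun k => \prod_l (A l (e i l) (e k l) * B l (e k l) (e j l))));
  last by move=> k _; rewrite !eE big_split.
under [RHS]eq_bigr do rewrite mxE.
by rewrite bigA_distr_bigA (reindex e) //=; apply: onW_bij.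
Qed.

Lemma trmx_big_tensmx (R : comNzRingType) d (A : 'I_d -> 'M[R]_2) :
  (big_tensmx A)^T = big_tensmx (fun l => (A l)^T).
Proof.
have [e _ eE] := big_tensmxE d.
by apply/matrixP=> i j; rewrite mxE !eE; apply: eq_bigr => l _; rewrite mxE.
Qed.

Lemma big_tensmx_scalar (R : comNzRingType) d (a : R) :
  big_tensmx (fun _ : 'I_d => a%:M) = (a ^+ d)%:M.
Proof.
have [e bij_e eE] := big_tensmxE d.
apply/matrixP=> i j; rewrite eE mxE -(inj_eq (bij_inj bij_e)).
have [->|/eqP ne_ij] := eqVneq (e i) (e j).
  by under eq_bigr do rewrite mxE eqxx; rewrite prodr_const card_ord.
have [/existsP[l ne_l]|/existsPn eq_ij] := boolP [exists l, e i l != e j l].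
  by rewrite (bigD1 l) //= mxE (negPf ne_l) mul0r.
by case: ne_ij; apply/ffunP=> l; apply/eqP; rewrite -[_ == _]negbK.
Qed.

Lemma mxtrace_big_tensmx (R : comNzRingType) d (A : 'I_d -> 'M[R]_2) :
  \tr (big_tensmx A) = \prod_l \tr (A l).
Proof.
have [e bij_e eE] := big_tensmxE d.
rewrite bigA_distr_bigA (reindex e) /=; last exact: onW_bij.
by apply: eq_bigr => i _; rewrite eE.
Qed.

(** Permuting the factors amounts to a simultaneous permutation of rows and columns. *)
Lemma char_poly_big_tensmx_perm (R : comNzRingType) d (A : 'I_d -> 'M[R]_2)
    (s : 'S_d) :
  char_poly (big_tensmx (fun l => A (s l))) = char_poly (big_tensmx A).
Proof.
have [e [e' eK e'K] eE] := big_tensmxE d.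
pose h i := e' [ffun l => e i ((s^-1)%g l)].
apply: (@char_poly_reindex _ _ _ h) => [|i j].
  exists (fun i => e' [ffun l => e i (s l)]) => i; rewrite /h e'K -[RHS]eK;
  by congr e'; apply/ffunP=> l; rewrite !ffunE ?permKV ?permK.
rewrite !eE /h !e'K (reindex_perm s^-1); apply: eq_bigr => l _.
by rewrite !ffunE permKV.
Qed.

Lemma map_big_tensmx (R S : comNzRingType) (f : {rmorphism R -> S}) d
    (A : 'I_d -> 'M[R]_2) :
  map_mx f (big_tensmx A) = big_tensmx (fun l => map_mx f (A l)).
Proof.
have [e _ eE] := big_tensmxE d; apply/matrixP=> i j.
by rewrite mxE !eE rmorph_prod; apply: eq_bigr => l _; rewrite mxE.
Qed.

Lemma eq_big_tensmx (R : comNzRingType) d (A B : 'I_d -> 'M[R]_2) :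
  A =1 B -> big_tensmx A = big_tensmx B.
Proof.
have [e _ eE] := big_tensmxE d => eqAB; apply/matrixP=> i j.
by rewrite !eE; apply: eq_bigr => l _; rewrite eqAB.
Qed.

Lemma map_transfer_mx (R S : comNzRingType) (f : {rmorphism R -> S}) (x s t : R) :
  map_mx f (transfer_mx x s t) = transfer_mx (f x) (f s) (f t).
Proof.
apply/matrixP=> i j; rewrite !mxE.
by case: ifP; case: ifP; rewrite ?rmorphD ?rmorphN ?rmorph1 ?rmorph0.
Qed.

(** * Characteristic polynomials *)

Lemma char_poly_tr (R : comNzRingType) n (A : 'M[R]_n) :
  char_poly A^T = char_poly A.
Proof.
rewrite /char_poly -det_tr; congr (\det _).
by apply/matrixP=> i j; rewrite !mxE eq_sym.
Qed.

Lemma char_poly_conj (R : comNzRingType) n (A P P' : 'M[R]_n) :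
  P *m P' = 1%:M -> char_poly (P *m A *m P') = char_poly A.
Proof.
move=> PP'; pose phi := map_mx (@polyC R).
have phiPP' : phi _ _ P *m phi _ _ P' = 1%:M.
  by rewrite -map_mxM PP' map_mx1.
rewrite /char_poly; have -> : char_poly_mx (P *m A *m P')
    = phi _ _ P *m char_poly_mx A *m phi _ _ P'.
  rewrite /char_poly_mx mulmxBr mulmxBl !map_mxM; congr (_ - _).
  by rewrite scalar_mxC -mulmxA phiPP' mulmx1.
by rewrite !det_mulmx mulrAC -det_mulmx phiPP' det1 mul1r.
Qed.

Lemma coef_char_polyZ (R : idomainType) n (b : R) (B : 'M[R]_n) k :
  b != 0 -> (k <= n)%N -> (char_poly (b *: B))`_k = b ^+ (n - k) * (char_poly B)`_k.
Proof.
move=> b_neq0 le_kn.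
have coefE : (char_poly (b *: B) \Po (b *: 'X))`_k = b ^+ k * (char_poly (b *: B))`_k.
  rewrite coef_comp_poly (eq_bigr (fun i : 'I__ => if i == k :> nat
      then b ^+ k * (char_poly (b *: B))`_k else 0)); last first.
    move=> i _; rewrite exprZn coefZ coefXn [k == i]eq_sym.
    by case: eqP => [->|_]; rewrite ?mulr1 ?mulr0 // mulrC.
  rewrite -big_mkcond /= (@big_ord1_eq _ 0 _ (fun=> b ^+ k * (char_poly (b *: B))`_k)).
  by rewrite size_char_poly ltnS le_kn.
(* det (b X - b B) = b^n det (X - B) *)
have scaleE : char_poly (b *: B) \Po (b *: 'X) = b ^+ n *: char_poly B.
  rewrite /char_poly -(det_map_mx (comp_poly (b *: 'X))).
  rewrite -[_ *: \det _]mul_polyC rmorphXn.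
  rewrite -detZ; congr (\det _); apply/matrixP=> i j; rewrite !mxE /=.
  by rewrite rmorphB rmorphMn /= comp_polyX comp_polyC polyCM mulrBr mulrnAr !mul_polyC.
apply: (mulfI (expf_neq0 k b_neq0)).
by rewrite -coefE scaleE coefZ mulrA -exprD subnKC.
Qed.

(** The product of [\det B] and [\det (X - A)] is [\det (X B - c)], which up to sign is the
    characteristic polynomial of [X B] evaluated at [c]. This compares the spectra of [B] and
    [c B^-1] without inverting [B]. *)
Lemma char_poly_mulmx_scalar (R : idomainType) n (A B : 'M[R]_n) c k :
  A *m B = c%:M -> (k <= n)%N ->
  \det B * (char_poly A)`_(n - k) = (-1) ^+ n * (c ^+ k * (char_poly B)`_k).
Proof.
move=> AB le_kn; pose phi (M : 'M[R]_n) := map_mx polyC M.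
have detE : \det B *: char_poly A = (-1) ^+ n *: (char_poly ('X *: phi B)).[c%:P].
  rewrite /char_poly -mul_polyC -det_map_mx mulrC -det_mulmx.
  rewrite -horner_evalE -(det_map_mx (horner_eval c%:P)).
  rewrite -mul_polyC rmorphXn rmorphN1 -detZ.
  congr (\det _).
  rewrite mulmxBl -map_mxM AB mul_scalar_mx scaleN1r.
  apply/matrixP=> i j; rewrite !mxE /= /horner_eval !(hornerE, hornerMn).
  by rewrite opprB rmorphMn.
have /(congr1 (fun p : {poly R} => p`_(n - k))) := detE.
rewrite !coefZ => ->; congr (_ * _).
rewrite (horner_coef_wide _ (n := n.+1)) ?size_char_poly // coef_sum.
(* The [i]-th summand is a constant times [X^(n - i)], so only [i = k] contributes. *)
rewrite (bigD1 (inord k)) //= big1 ?addr0 => [|i ne_ik].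
  rewrite inordK // coef_char_polyZ ?polyX_eq0 // -map_char_poly coef_map /=.
  by rewrite -mulrA coefXnM ltnn subnn -rmorphXn -rmorphM coefC eqxx mulrC.
have le_in : (i <= n)%N by rewrite -ltnS.
rewrite coef_char_polyZ ?polyX_eq0 // -map_char_poly coef_map /=.
rewrite -mulrA -rmorphXn -rmorphM coefMC coefXn eqn_sub2lE //.
have -> : (k == i) = false.
  by apply: contraNF ne_ik => /eqP->; rewrite inord_val.
by rewrite mul0r.
Qed.

Lemma matrix_linear_recurrence (R : comNzRingType) n p (A : 'M[R]_n)
    (V : nat -> 'M[R]_(n, p)) :
  (forall m, V m.+1 = A *m V m) ->
  \sum_(i < n.+1) (char_poly A)`_i *: V i = 0.
Proof.
case: n A V => [|n] A V VS; first by apply/matrixP=> [[]].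
have VE m : V m = A ^+ m *m V 0%N.
  by elim: m => [|m IH]; rewrite ?expr0 ?mul1mx // VS IH exprS mulmxA.
have := congr1 (mulmx^~ (V 0%N)) (Cayley_Hamilton A); rewrite mul0mx => CH.
rewrite -[RHS]CH -[X in horner_mx A X]coefK poly_def size_char_poly.
rewrite linear_sum /= mulmx_suml.
apply: eq_bigr => i _.
by rewrite linearZ /= rmorphXn /= horner_mx_X VE scalemxAl.
Qed.

Lemma transfer_product_recurrence (R : comNzRingType) d (x : 'I_d -> R) (s t : R)
    (u : 'I_d -> nat -> R) :
  (forall l m, u l m.+2 = (x l + s) * u l m.+1 - t * u l m) ->
  \sum_(i < (2 ^ d).+1)
    (char_poly (big_tensmx (fun l => transfer_mx (x l) s t)))`_i * \prod_l u l i = 0.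
Proof.
move=> uE; have [e [e' eK e'K] eE] := big_tensmxE d.
(* (u_(m+1), - u_m) |-> (u_(m+2), - u_(m+1)) is the action of the transfer matrix. *)
pose w l m (j : 'I_2) := if j == 0 then u l m.+1 else - u l m.
pose V m : 'cV[R]_(2 ^ d) := \col_i \prod_l w l m (e i l).
have VS m : V m.+1 = big_tensmx (fun l => transfer_mx (x l) s t) *m V m.
  apply/matrixP=> i j; rewrite !mxE.
  rewrite (eq_bigr (fun k =>
      \prod_l (transfer_mx (x l) s t (e i l) (e k l) * w l m (e k l))));
    last by move=> k _; rewrite !mxE eE big_split.
  rewrite -(reindex e (P := xpredT)
    (F := fun f : {ffun _} =>
      \prod_l (transfer_mx (x l) s t (e i l) (f l) * w l m (f l))));
    last by exists e' => j' _.
  rewrite -(bigA_distr_bigA (fun l j => transfer_mx (x l) s t (e i l) j * w l m j)).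
  apply: eq_bigr => l _; rewrite !big_ord_recl big_ord0 !mxE /w uE /=.
  by case: (e i l == 0); rewrite ?mulrN ?mulN1r ?mul0r !addr0 ?subr0.
(* The entry with second coordinate in every factor is the product of the [- u l m], that is
   [(-1)^d] times the wanted product. *)
have /matrixP/(_ (e' [ffun=> lift ord0 ord0]) 0) := matrix_linear_recurrence VS.
rewrite summxE mxE => sum0; apply: (inv_inj (signrMK d)).
rewrite mulr0 -[RHS]sum0 mulr_sumr; apply: eq_bigr => i _; rewrite !mxE e'K mulrCA.
congr (_ * _); rewrite -[in (-1) ^+ d](card_ord d) -prodr_const -big_split.
by apply: eq_bigr => l _; rewrite /w ffunE /= mulN1r.
Qed.

Lemma det_transfer_mx (R : comNzRingType) (x s t : R) :
  \det (transfer_mx x s t) = t.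
Proof.
rewrite (expand_det_row _ ord0) !big_ord_recl big_ord0 /cofactor !det_mx11 !mxE /=.
by rewrite expr0 expr1 mul1r mulr0 add0r addr0 mulrN1 opprK mulr1.
Qed.

Lemma mxtrace_transfer_mx (R : comNzRingType) (x s t : R) :
  \tr (transfer_mx x s t) = x + s.
Proof. by rewrite /mxtrace !big_ord_recl big_ord0 !mxE /= !addr0. Qed.

(** The relation is kept free of division; [t] is cancelled only after specialisation to [K]. *)
Lemma char_poly_transfer_palindromic (R : idomainType) d (x : 'I_d -> R) (s t : R) k :
  let T := big_tensmx (fun l => transfer_mx (x l) s t) in
  (0 < d)%N -> (k <= 2 ^ d)%N ->
  t ^+ (d * 2 ^ d.-1) * (char_poly T)`_(2 ^ d - k) = t ^+ (d * k) * (char_poly T)`_k.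
Proof.
move=> T d_gt0 le_k.
(* t M^-1 = J M^T J^-1 for every transfer matrix M. *)
pose J : 'M[R]_2 := \matrix_(i, j) if i == j then 0 else if i == 0 then 1 else -1.
have JJT : J *m J^T = 1%:M.
  apply/matrixP=> -[[|[|//]] ?] [[|[|//]] ?];
  rewrite !mxE !big_ord_recl big_ord0 !mxE /=; ring.
have MJ l : transfer_mx (x l) s t *m (J *m (transfer_mx (x l) s t)^T *m J^T) = t%:M.
  apply/matrixP=> -[[|[|//]] ?] [[|[|//]] ?];
  rewrite !(mxE, big_ord_recl, big_ord0) /=;
  ring.
pose bigJ := big_tensmx (fun _ : 'I_d => J).
pose bigJ' := big_tensmx (fun _ : 'I_d => J^T).
have bigJJ' : bigJ *m bigJ' = 1%:M.
  by rewrite big_tensmx_mul (eq_big_tensmx (fun=> JJT)) big_tensmx_scalar expr1n.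
have TQ : T *m (bigJ *m T^T *m bigJ') = (t ^+ d)%:M.
  by rewrite trmx_big_tensmx !big_tensmx_mul (eq_big_tensmx MJ) big_tensmx_scalar.
have detQ : \det (bigJ *m T^T *m bigJ') = t ^+ (d * 2 ^ d.-1).
  rewrite !det_mulmx mulrAC -det_mulmx bigJJ' det1 mul1r det_tr det_big_tensmx //.
  by under eq_bigr do rewrite det_transfer_mx; rewrite prodr_const card_ord exprM.
have := char_poly_mulmx_scalar TQ le_k.
rewrite detQ char_poly_conj // char_poly_tr => ->.
(* The size [2^d] is even because [d >= 1]. *)
have -> : (-1) ^+ (2 ^ d) = 1 :> R.
  by rewrite -(prednK d_gt0) expnS exprM sqrrN !expr1n.
by rewrite mul1r -exprM.
Qed.

(** * Christoffel's formula *)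

(** Row [n] is the first unit vector; expanding along it gives the sign [(-1)^n] and the same shape
    with [d] lowered by one. At [d = 0] the matrix is unitriangular. *)
Lemma det_shifted_trig (R : comNzRingType) n d N (a : nat -> nat -> R) :
  N = (d + n)%N -> (forall i, a i (i + d)%N = 1) ->
  (forall i j, (i + d < j)%N -> a i j = 0) ->
  \det (\matrix_(i < N, j < N) if (i < n)%N then a i j else (j == (i - n)%N :> nat)%:R)
    = (-1) ^+ (n * d).
Proof.
move=> ->; elim: d a => [|d IH] a a_diag a_trig.
  rewrite muln0 det_trig => [|]; last first.
    apply/is_trig_mxP=> i j lt_ij; rewrite mxE ltn_ord a_trig ?addn0 //.
  by rewrite big1 // => i _; rewrite mxE ltn_ord -[X in a _ X]addn0 a_diag.
have lt_n : (n < d.+1 + n)%N by rewrite addSn ltnS leq_addl.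
rewrite (expand_det_row _ (Ordinal lt_n)) (bigD1 ord0) //=.
rewrite big1 ?addr0 => [|j ne_j0]; last first.
  by move: ne_j0; rewrite -val_eqE !mxE ltnn subnn /= => /negPf->; rewrite mul0r.
rewrite !mxE ltnn subnn eqxx mul1r /cofactor addn0 mulnS exprD; congr (_ * _).
rewrite -(IH (fun i j => a i j.+1)) => [|i|i j lt_ij]; last first.
- by rewrite a_trig // addnS ltnS.
- by rewrite -addnS a_diag.
congr (\det _); apply/matrixP=> i j; rewrite !mxE /= /bump leq0n add1n.
have [lt_in|le_ni] := ltnP i n; first by rewrite add0n lt_in.
by rewrite add1n ltnNge leqW // subSn.
Qed.

Lemma scalar_poly_coef (R : comNzRingType) (L : {scalar {poly R}}) (f g : {poly R}) N :
  (size f <= N)%N -> L (f * g) = \sum_(i < N) f`_i * L ('X^i * g).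
Proof.
move=> le_fN; rewrite -[f in LHS](coefK f) poly_def.
rewrite (big_ord_widen _ (fun i => f`_i *: 'X^i) le_fN).
rewrite big_mkcond mulr_suml linear_sum; apply: eq_bigr => i _.
case: ltnP => [_|le_fi]; first by rewrite -scalerAl linearZ.
by rewrite nth_default // !mul0r linear0.
Qed.

Lemma det_coef_monic (R : comNzRingType) (p : nat -> {poly R}) n :
  (forall i, p i \is monic) -> (forall i, size (p i) = i.+1) ->
  \det (\matrix_(i < n, j < n) (p i)`_j) = 1.
Proof.
move=> p_monic p_size; rewrite det_trig => [|]; last first.
  by apply/is_trig_mxP=> i j lt_ij; rewrite mxE nth_default // p_size.
rewrite big1 // => i _; rewrite mxE; have /monicP := p_monic i.
by rewrite /lead_coef p_size.
Qed.

Section Christoffel.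
Variables (R : comNzRingType) (L : {scalar {poly R}}).
Variables (p : nat -> {poly R}) (omega : nat -> R).
Hypothesis p_monic : forall n, p n \is monic.
Hypothesis p_size : forall n, size (p n) = n.+1.
Hypothesis p_orth : forall m n, L (p m * p n) = if m == n then omega n else 0.

(** The change of basis from monomials to the [p i] is unitriangular. *)
Lemma det_hankel_basis n (q : {poly R}) :
  \det (\matrix_(i < n, j < n) L ('X^(i + j) * q))
  = \det (\matrix_(i < n, j < n) L (p i * p j * q)).
Proof.
pose P := \matrix_(i < n, j < n) (p i)`_j.
set Hq := \matrix_(i, j) _; have detP : \det P = 1 by exact: det_coef_monic.
have -> : \det Hq = \det (P *m Hq *m P^T).
  by rewrite !det_mulmx det_tr detP mul1r mulr1.
congr (\det _); apply/matrixP=> i j; rewrite !mxE.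
have le_p (k : 'I_n) : (size (p k) <= n)%N by rewrite p_size.
rewrite [p i * p j]mulrC -mulrA (scalar_poly_coef _ _ (le_p j)).
apply: eq_bigr => k _; rewrite !mxE mulrC; congr (_ * _).
rewrite mulrCA (scalar_poly_coef _ _ (le_p i)); apply: eq_bigr => m _.
by rewrite !mxE exprD mulrA.
Qed.

Lemma christoffel n d (y : 'I_d -> R) :
  \det (\matrix_(i < n, j < n) L ('X^(i + j) * \prod_l ('X - (y l)%:P)))
    * \det (\matrix_(k < d, l < d) y l ^+ k)
  = (-1) ^+ (n * d) * (\prod_(j < n) omega j)
    * \det (\matrix_(k < d, l < d) (p (n + k)).[y l]).
Proof.
set q := \prod_l _; rewrite det_hankel_basis.
have q_size : size q = d.+1 by rewrite size_prod_XsubC /index_enum -enumT size_enum_ord.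
have q_monic : q \is monic by exact: monic_prod_XsubC.
have qp_size i : size (q * p i) = (i + d).+1.
  by rewrite size_monicM // ?p_size ?q_size ?monic_neq0 // addSn addnC.
(* A and P contain the coefficients of two bases of the polynomials of degree
   < n + d, namely q p_i, X^k and p_r; F applies to the monomials the functionals
   L (. p_j), which kill the p_r with r >= n, and evaluation at y_l, which kills
   the q p_i.  So A F and P F are both block triangular. *)
pose A := \matrix_(i < n + d, j < n + d)
  if (i < n)%N then (q * p i)`_j else (j == (i - n)%N :> nat)%:R.
pose P := \matrix_(i < n + d, j < n + d) (p i)`_j.
pose F := row_mx (\matrix_(r < n + d, j < n) L ('X^r * p j))
                 (\matrix_(r < n + d, l < d) y l ^+ r).
have detA : \det A = (-1) ^+ (n * d).
  apply: (det_shifted_trig (a := fun i j => (q * p i)`_j)) => [|i|i j lt_ij].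
  - exact: addnC.
  - have : q * p i \is monic by rewrite monicMr.
    by move/monicP; rewrite /lead_coef qp_size.
  - by rewrite nth_default // qp_size.
have AF : A *m F = block_mx (\matrix_(i < n, j < n) L (p i * p j * q)) 0
    (\matrix_(k < d, j < n) L ('X^k * p j)) (\matrix_(k < d, l < d) y l ^+ k).
  rewrite mul_mx_row -[A *m _]vsubmxK -[X in row_mx _ X]vsubmxK -[RHS]/(col_mx _ _).
  rewrite -block_mxEh; congr block_mx; apply/matrixP=> i j; rewrite !mxE.
  - under eq_bigr do rewrite !mxE /= ltn_ord.
    rewrite -scalar_poly_coef ?qp_size; last by rewrite -addSn leq_add2r.
    by congr (L _); rewrite [RHS]mulrC mulrA.
  - under eq_bigr do rewrite !mxE /= ltn_ord.
    rewrite -horner_coef_wide ?qp_size; last by rewrite -addSn leq_add2r.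
    by rewrite hornerM horner_prod (bigD1 j) //= hornerXsubC subrr !mul0r.
  - under eq_bigr do rewrite !mxE /= ltnNge leq_addr addKn.
    rewrite (bigD1 (Ordinal (ltn_addl n (ltn_ord i)))) //= eqxx mul1r big1 ?addr0 //.
    by move=> k ne_k; rewrite (negPf (_ : _ != _)) ?mul0r.
  - under eq_bigr do rewrite !mxE /= ltnNge leq_addr addKn.
    rewrite (bigD1 (Ordinal (ltn_addl n (ltn_ord i)))) //= eqxx mul1r big1 ?addr0 //.
    by move=> k ne_k; rewrite (negPf (_ : _ != _)) ?mul0r.
have PF : P *m F = block_mx (diag_mx (\row_(j < n) omega j)) 
    (\matrix_(i < n, l < d) (p i).[y l]) 0 (\matrix_(k < d, l < d) (p (n + k)).[y l]).
  rewrite mul_mx_row -[P *m _]vsubmxK -[X in row_mx _ X]vsubmxK.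
  rewrite -block_mxEh; congr block_mx; apply/matrixP=> i j; rewrite !mxE;
    under eq_bigr do rewrite !mxE /=.
  - rewrite -scalar_poly_coef ?p_size ?p_orth; last by rewrite ltn_addr.
    by rewrite -val_eqE; case: eqP => // ->.
  - by rewrite -horner_coef_wide ?p_size // ltn_addr.
  - rewrite -scalar_poly_coef ?p_size ?p_orth ?ltn_add2l //.
    by rewrite gtn_eqF // ltn_addr.
  - by rewrite -horner_coef_wide ?p_size ?ltn_add2l.
(* Both identities express [\det F]: [P] has determinant 1 and [A] has determinant [(-1)^(nd)]. *)
have := congr1 (fun M : 'M_(n + d) => \det M) AF.
have := congr1 (fun M : 'M_(n + d) => \det M) PF.
rewrite /= !det_mulmx det_coef_monic // mul1r det_ublock det_lblock det_diag => -> detE.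
rewrite -detE detA -mulrA; congr (_ * (_ * _)).
by apply: eq_bigr => j _; rewrite mxE.
Qed.
End Christoffel.

(** * Extension of scalars to polynomials in the roots *)

(* The functional with given moments, needed to extend [L] from [K] to
   [{mpoly K[d]}]. *)
Definition moment_functional (R : comNzRingType) (mu : nat -> R) (f : {poly R}) : R :=
  \sum_(i < size f) f`_i * mu i.

Lemma moment_functional_wide (R : comNzRingType) (mu : nat -> R) (f : {poly R}) n :
  (size f <= n)%N -> moment_functional mu f = \sum_(i < n) f`_i * mu i.
Proof.
move=> le_fn; rewrite /moment_functional (big_ord_widen _ (fun i => f`_i * mu i) le_fn).
rewrite big_mkcond; apply: eq_bigr => i _.
by case: ltnP => // le_fi; rewrite nth_default ?mul0r.
Qed.

Lemma moment_functional_scalar (R : comNzRingType) (mu : nat -> R) :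
  scalar (moment_functional mu).
Proof.
move=> a f g; set n := maxn (size f) (size g).
have le_f : (size f <= n)%N by rewrite leq_maxl.
have le_g : (size g <= n)%N by rewrite leq_maxr.
rewrite (moment_functional_wide _ le_f) (moment_functional_wide _ le_g).
rewrite (@moment_functional_wide _ _ _ n); last first.
  rewrite (leq_trans (size_polyD _ _)) // geq_max le_g andbT.
  exact: leq_trans (size_scale_leq _ _) le_f.
rewrite mulr_sumr -big_split; apply: eq_bigr => i _.
by rewrite /= coefD coefZ mulrDl mulrA.
Qed.

HB.instance Definition _ (R : comNzRingType) (mu : nat -> R) :=
  GRing.isLinear.Build R {poly R} R *%R (moment_functional mu)
    (moment_functional_scalar mu).

Lemma moment_functionalXn (R : comNzRingType) (mu : nat -> R) n :
  moment_functional mu 'X^n = mu n.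
Proof.
rewrite /moment_functional size_polyXn big_ord_recr /= coefXn eqxx mul1r big1 ?add0r //.
by move=> i _; rewrite coefXn ltn_eqF // mul0r.
Qed.

(** Orthogonality of the [p n] thereby survives the extension of scalars. *)
Lemma map_moment_functional (K : fieldType) (R : comNzRingType) (f : {rmorphism K -> R})
    (L : {scalar {poly K}}) (q : {poly K}) :
  moment_functional (f \o moment L) (map_poly f q) = f (L q).
Proof.
rewrite /moment_functional size_map_poly -[X in L X]mulr1.
rewrite (scalar_poly_coef L 1 (leqnn _)).
rewrite rmorph_sum; apply: eq_bigr => i _.
by rewrite coef_map rmorphM /= mulr1.
Qed.

(** Vieta's formulas for the roots [- 'X_l]: the sign [(-1)^(d - k)] cancels against the [d - k]
    signs in each monomial. *)
Lemma prod_XaddX (K : idomainType) d :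
  \prod_l ('X - (- ('X_l : {mpoly K[d]}))%:P)
    = \sum_(k < d.+1) mesym d K (d - k) *: 'X^k.
Proof.
pose cs := [tuple - ('X_l : {mpoly K[d]}) | l < d].
have -> : \prod_l ('X - (- ('X_l : {mpoly K[d]}))%:P) = \prod_(c <- cs) ('X - c%:P).
  by rewrite big_tuple; apply: eq_bigr => l _; rewrite tnth_mktuple.
have size_cs : size (\prod_(c <- cs) ('X - c%:P)) = d.+1.
  by rewrite size_prod_XsubC size_tuple.
rewrite -[LHS]coefK poly_def size_cs; apply: eq_bigr => k _; congr (_ *: _).
have le_kd : (k <= d)%N by rewrite -ltnS.
have := mroots_coeff cs (inord (d - k)).
rewrite inordK ?ltnS ?leq_subr // subKn // => ->.
rewrite /mesym rmorph_sum mulr_sumr; apply: eq_bigr => h /eqP card_h.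
rewrite rmorph_prod -card_h -prodr_const -big_split; apply: eq_bigr => l _ /=.
by rewrite mevalXU tnth_mktuple mulN1r opprK.
Qed.

(** This allows the Vandermonde factor in Christoffel's formula to be cancelled. Two distinct
    indeterminates differ in the coefficient at [U_(i)]. *)
Lemma vandermonde_mpoly_neq0 (K : idomainType) d :
  \det (\matrix_(k < d, l < d) (- ('X_l : {mpoly K[d]})) ^+ k) != 0.
Proof.
have -> : \matrix_(k < d, l < d) (- ('X_l : {mpoly K[d]})) ^+ k
    = Vandermonde d (\row_l - 'X_l).
  by apply/matrixP=> k l; rewrite !mxE.
rewrite det_Vandermonde; apply/prodf_neq0 => i _; apply/prodf_neq0 => j lt_ij.
rewrite !mxE opprK addrC subr_eq0; apply: contraTneq lt_ij => /(congr1 (mcoeff U_(i))).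
rewrite !mcoeffX eqxx; case: eqP => [/mnmP/(_ i)|_ /eqP]; last by rewrite oner_eq0.
by rewrite !mnm1E eqxx; case: eqP => // ->; rewrite ltnn.
Qed.

(** * Norms of the orthogonal polynomials and normalisation of the Hankel determinants *)

Section Orthogonal.
Variables (K : fieldType) (L : {scalar {poly K}}).
Hypothesis mu0 : moment L 0 = 1.
Variables (p : nat -> {poly K}) (omega : nat -> K).
Hypothesis p_monic : forall n, p n \is monic.
Hypothesis p_size : forall n, size (p n) = n.+1.
Hypothesis p_orth : forall m n, L (p m * p n) = if m == n then omega n else 0.
Variables (s_ t_ : nat -> K).
Hypothesis p0E : p 0%N = 1.
Hypothesis p1E : p 1%N = ('X - (s_ 0%N)%:P) * p 0%N.
Hypothesis p_rec : forall n, (2 <= n)%N ->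
  p n = ('X - (s_ n.-1)%:P) * p n.-1 - (t_ n.-2)%:P * p n.-2.

Lemma omega0 : omega 0 = 1.
Proof.
by have := p_orth 0 0; rewrite eqxx p0E mulr1 => <-; rewrite -mu0 /moment expr0.
Qed.

(** Both sides equal [L (X p_n p_(n+1))]: the recurrence rewrites [X p_n] in one case and
    [X p_(n+1)] in the other. *)
Lemma omegaS n : omega n.+1 = t_ n * omega n.
Proof.
have Lcmul (c : K) f : L (c%:P * f) = c * L f by rewrite mul_polyC linearZ.
transitivity (L (p n.+1 * ('X * p n))).
  (* The pair [b], [k] covers [p_1], where [b = 0], together with the general recurrence. *)
  have [b [k] ne_k pE] : exists b : K, exists2 k, n.+1 != k &
      p n.+1 = ('X - (s_ n)%:P) * p n - b%:P * p k.
    case: n => [|n]; first by exists 0, 0%N; rewrite ?p1E ?mul0r ?subr0.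
    exists (t_ n), n; first by rewrite gtn_eqF.
    exact: (p_rec (n := n.+2)).
  have -> : 'X * p n = p n.+1 + (s_ n)%:P * p n + b%:P * p k by rewrite pE; ring.
  rewrite !mulrDr !linearD /= ![p n.+1 * (_%:P * _)]mulrCA !Lcmul !p_orth eqxx.
  by rewrite (negPf ne_k) -[n.+1 == n]eqSS gtn_eqF // !mulr0 !addr0.
have -> : p n.+1 * ('X * p n) = p n * p n.+2 + (s_ n.+1)%:P * (p n * p n.+1)
    + (t_ n)%:P * (p n * p n) by rewrite (p_rec (n := n.+2)) //=; ring.
rewrite !linearD /= !Lcmul !p_orth eqxx !ltn_eqF // ?mulr0 ?addr0 ?add0r //.
Qed.

Variable t : K.
Hypothesis t_const : forall i, (1 <= i)%N -> t_ i = t.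

Lemma prod_omega n : \prod_(j < n.+1) omega j = t_ 0%N ^+ n * t ^+ 'C(n, 2).
Proof.
have omegaE m : omega m.+1 = t_ 0%N * t ^+ m.
  elim: m => [|m IH]; first by rewrite omegaS omega0.
  by rewrite omegaS t_const // IH mulrCA exprS.
elim: n => [|n IH]; first by rewrite big_ord1 omega0 mulr1.
by rewrite big_ord_recr IH /= omegaE binS bin1 exprSr exprD mulrACA.
Qed.

(** The index is shifted to be positive: at index 0 the left side would be [t_ 0 / t], against the
    empty product 1. *)
Lemma hankel_scaling n :
  t_ 0%N ^ (- (n.+1%:Z - 1)) * t ^ (- ((n.+1%:Z - 1) * (n.+1%:Z - 2) %/ 2)%Z)
  = (\prod_(j < n.+1) omega j)^-1.
Proof.
have -> : n.+1%:Z - 1 = n by rewrite -addn1 PoszD addrK.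
have -> : ((n%:Z * (n.+1%:Z - 2)) %/ 2)%Z = 'C(n, 2).
  case: n => // n; rewrite bin2 /= -divn2 -divz_nat; congr (_ %/ _)%Z.
  by rewrite PoszM; congr (_ * _); rewrite -addn2 PoszD addrK.
by rewrite prod_omega invfM !exprnN.
Qed.

End Orthogonal.

(** * Recurrence for indeterminate roots *)

Section Universal.
Variables (K : fieldType) (L : {scalar {poly K}}).
Variables (p : nat -> {poly K}) (omega : nat -> K).
Hypothesis p_monic : forall n, p n \is monic.
Hypothesis p_size : forall n, size (p n) = n.+1.
Hypothesis omega_neq0 : forall n, omega n != 0.
Hypothesis p_orth : forall m n, L (p m * p n) = if m == n then omega n else 0.
Variables s t : K.
Hypothesis p_const_rec : forall n, (3 <= n)%N ->
  p n = ('X - s%:P) * p n.-1 - t%:P * p n.-2.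
Variable d : nat.

Notation R := {mpoly K[d]}.
Notation T := (big_tensmx (fun l => transfer_mx ('X_l : R) s%:MP t%:MP)).

(* [lam k] is replaced by the elementary symmetric polynomial [d - k] in the
   indeterminates, and by [hankel_scaling] the product of the [omega j] is the
   normalisation of [scaled_hankel], except at [n = 0]. *)
Definition mesym_hankel n : R :=
  (\prod_(j < n) omega j)^-1%:MP *
  \det (\matrix_(i < n, j < n)
    \sum_(k < d.+1) mesym d K (d - k) * (moment L (i + j + k))%:MP).

Let pX n : {poly R} := map_poly (@mpolyC d K) (p n).
Let V : R := \det (\matrix_(k < d, l < d) (- 'X_l) ^+ k).

(** Christoffel's formula at [y l = - 'X_l], where the normalisation cancels the product of the
    norms. *)
Lemma mesym_hankelE n :
  mesym_hankel n * V
  = (-1) ^+ (n * d) * \det (\matrix_(k < d, l < d) (pX (n + k)).[- 'X_l]).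
Proof.
pose mu := (@mpolyC d K) \o moment L.
have pX_monic m : pX m \is monic by rewrite map_monic.
have pX_size m : size (pX m) = m.+1 by rewrite size_map_poly.
have pX_orth m k : moment_functional mu (pX m * pX k)
    = if m == k then (omega k)%:MP else 0.
  by rewrite -rmorphM map_moment_functional p_orth; case: ifP.
have := christoffel pX_monic pX_size pX_orth n (fun l : 'I_d => - 'X_l).
rewrite -rmorph_prod prod_XaddX.
have -> : \matrix_(i < n, j < n) moment_functional mu
      ('X^(i + j) * \sum_(k < d.+1) mesym d K (d - k) *: 'X^k)
    = \matrix_(i < n, j < n)
      \sum_(k < d.+1) mesym d K (d - k) * (moment L (i + j + k))%:MP.
  apply/matrixP=> i j; rewrite !mxE mulr_sumr linear_sum; apply: eq_bigr => k _.
  by rewrite -scalerAr linearZ -exprD /= moment_functionalXn.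
have cancel_omega (a w e D g v : R) :
    a * w = 1 -> g * v = e * w * D -> a * g * v = e * D.
  by move=> aw gv; rewrite -mulrA gv -mulrA mulrCA [a * _]mulrA aw mul1r.
apply: cancel_omega.
rewrite -mpolyCM.
have -> : (\prod_(j < n) omega j)^-1 * \prod_(i < n) omega i = 1.
  by rewrite mulVf //; apply/prodf_neq0 => j _.
by rewrite mpolyC1.
Qed.

Lemma mesym_hankel_recurrence n : (0 < n)%N ->
  \sum_(i < (2 ^ d).+1) (char_poly T)`_i * mesym_hankel (n + i) = 0.
Proof.
move=> n_gt0; apply: (mulIf (vandermonde_mpoly_neq0 K d)); rewrite mul0r mulr_suml.
(* Leibniz expansion of the transpose. The sign [(-1)^(id)] is spread over the [d] factors, which
   turns the coefficient [- 'X_l - s] into ['X_l + s]. *)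
have detE i : mesym_hankel (n + i) * V = \sum_(sg : 'S_d)
    ((-1) ^+ (n * d) * (-1) ^+ sg) * \prod_l ((-1) ^+ i * (pX (n + i + sg l)).[- 'X_l]).
  rewrite mesym_hankelE -det_tr mulr_sumr; apply: eq_bigr => sg _.
  rewrite big_split prodr_const card_ord /= -exprM mulnDl exprD -!mulrA; congr (_ * _).
  rewrite mulrCA; congr (_ * (_ * _)).
  by apply: eq_bigr => l _; rewrite !mxE.
under eq_bigr do rewrite -mulrA detE mulr_sumr.
rewrite exchange_big big1 //= => sg _.
under eq_bigr do rewrite mulrCA.
rewrite -mulr_sumr; pose u l i : R := (-1) ^+ i * (pX (n + i + sg l)).[- 'X_l].
rewrite (transfer_product_recurrence (u := u)) ?mulr0 // => l m.
(* The recurrence for [p_(k+2)] involves [t_k], which is known to be [t] from [k = 1] on; this is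
   where [0 < n] enters. *)
have pX_rec k : (0 < k)%N -> (pX k.+2).[- 'X_l]
    = (- 'X_l - s%:MP) * (pX k.+1).[- 'X_l] - t%:MP * (pX k).[- 'X_l].
  move=> k_gt0; rewrite /pX p_const_rec //= rmorphB !rmorphM rmorphB /=.
  by rewrite map_polyX !map_polyC !hornerE.
rewrite /u !addnS !addSn pX_rec ?addn_gt0 ?n_gt0 // !exprS; ring.
Qed.
End Universal.

(** * Specialisation *)

Local Notation mesym_tuple d K := [tuple mesym d K i.+1 | i < d].

(** Uniqueness is the algebraic independence of the elementary symmetric polynomials. *)
Lemma symf_eq (K : fieldType) d (f g : {mpoly K[d]}) :
  f \is symmetric -> g \mPo mesym_tuple d K = f -> symf f = g.
Proof. by move=> f_sym gE; apply: msym_fundamental_un; rewrite -symfP. Qed.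

Lemma symf_mesym0 (K : fieldType) d : symf (mesym d K 0) = 1.
Proof.
by apply: symf_eq; rewrite ?mesym_sym // mesym0E comp_mpoly1.
Qed.

Lemma symf_mesymS (K : fieldType) d (j : 'I_d) : symf (mesym d K j.+1) = 'X_j.
Proof.
by apply: symf_eq; rewrite ?mesym_sym // comp_mpolyXU -tnth_nth tnth_mktuple.
Qed.

(** The variable ['X_j] stands for [e_(j+1)], hence receives [lam (d - j.+1)]; [lam d] corresponds
    to [e_0 = 1] and has no variable. *)
Lemma meval_symf_mesym (K : fieldType) d (lam : nat -> K) k :
  lam d = 1 -> (k <= d)%N ->
  (symf (mesym d K (d - k))).@[fun j : 'I_d => lam (d - j.+1)%N] = lam k.
Proof.
move=> lam_d; rewrite leq_eqVlt => /predU1P[->|lt_kd].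
  by rewrite subnn symf_mesym0 meval1.
have lt_j : (d - k.+1 < d)%N by rewrite ltn_subrL (leq_ltn_trans _ lt_kd).
have -> : (d - k = (Ordinal lt_j).+1)%N by rewrite /= subnSK.
by rewrite symf_mesymS mevalXU /= subnSK // subKn // ltnW.
Qed.

(** Permuting the indeterminates permutes the tensor factors. *)
Lemma char_poly_transfer_symmetric (K : fieldType) d (s t : K) i :
  (char_poly (big_tensmx
     (fun l => transfer_mx ('X_l : {mpoly K[d]}) s%:MP t%:MP)))`_i \is symmetric.
Proof.
pose A l := transfer_mx ('X_l : {mpoly K[d]}) s%:MP t%:MP.
apply/issymP=> sg; rewrite -coef_map map_char_poly map_big_tensmx.
rewrite (eq_big_tensmx (B := fun l => A (sg l))) => [|l].
  by rewrite (char_poly_big_tensmx_perm A).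
by rewrite map_transfer_mx /= /msym mmapX mmap1U !mmapC.
Qed.

Lemma mmap_mesym (K S : comNzRingType) (f : {rmorphism K -> S}) d (x : 'I_d -> S) k :
  mmap f x (mesym d K k) = (mesym d S k).@[x].
Proof.
rewrite /mesym !rmorph_sum; apply: eq_bigr => h _.
rewrite !rmorph_prod; apply: eq_bigr => i _ /=.
by rewrite mevalXU mmapX mmap1U.
Qed.

(** This links the two specialisations: of the roots to [x], and of their elementary symmetric
    polynomials to [v]. *)
Lemma mmap_comp_mesym (K S : comNzRingType) (f : {rmorphism K -> S}) d (x : 'I_d -> S)
    (v : 'I_d -> K) (q : {mpoly K[d]}) :
  (forall j : 'I_d, f (v j) = (mesym d S j.+1).@[x]) ->
  mmap f x (q \mPo mesym_tuple d K) = f q.@[v].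
Proof.
move=> fv; rewrite comp_mpolyE mevalE !rmorph_sum; apply: eq_bigr => m _ /=.
rewrite mmapZ rmorphM !rmorph_prod; congr (_ * _); apply: eq_bigr => j _ /=.
by rewrite !rmorphXn /= tnth_mktuple mmap_mesym fv.
Qed.

Theorem corollary9 (K : fieldType) (charK : [pchar K] =i pred0)
    (L : {scalar {poly K}}) (mu0 : moment L 0 = 1)
    (p : nat -> {poly K}) (omega : nat -> K)
    (p_monic : forall n, p n \is monic)
    (p_size : forall n, size (p n) = n.+1)
    (omega_neq0 : forall n, omega n != 0)
    (p_orth : forall m n, L (p m * p n) = if m == n then omega n else 0)
    (s_ t_ : nat -> K) (t_neq0 : forall n, t_ n != 0)
    (p0E : p 0%N = 1)
    (p1E : p 1%N = ('X - (s_ 0%N)%:P) * p 0%N)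
    (p_rec : forall n, (2 <= n)%N ->
       p n = ('X - (s_ n.-1)%:P) * p n.-1 - (t_ n.-2)%:P * p n.-2)
    (s t : K)
    (s_const : forall i, (1 <= i)%N -> s_ i = s)
    (t_const : forall i, (1 <= i)%N -> t_ i = t)
    (d : nat) (d_ge1 : (1 <= d)%N)
    (lam : nat -> K) (lam_d : lam d = 1) :
  let H := scaled_hankel (moment L) lam d (t_ 0%N) t in
  exists c : nat -> K,
    [/\ c 0%N = 1,
        (forall n, (2 ^ d < n)%N ->
           \sum_(i < (2 ^ d).+1) c i * H (n - i)%N = 0),
        (* for every algebraic closure iota : K -> Kbar of K *)
        (forall (Kbar : closedFieldType) (iota : {rmorphism K -> Kbar}),
           (forall z : Kbar, algebraicOver iota z) ->
           forall x : 'I_d -> Kbar,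
           (forall k, (k <= d)%N ->
              iota (lam k) = (mesym d Kbar (d - k)).@[x]) ->
           \sum_(i < (2 ^ d).+1) iota (c i) *: 'X^(2 ^ d - i)
             = char_poly
                 (big_tensmx (fun i => transfer_mx (x i) (iota s) (iota t)))),
        c 1%N = - \sum_(j < d.+1) lam j * s ^+ j
      & forall i, (i <= 2 ^ d)%N ->
          c (2 ^ d - i)%N = t ^ (d%:Z * ((2 ^ d.-1)%N%:Z - i%:Z)) * c i].
Proof.
move=> H.
pose chi : {poly {mpoly K[d]}} :=
  char_poly (big_tensmx (fun l => transfer_mx ('X_l : {mpoly K[d]}) s%:MP t%:MP)).
have chi_sym i : chi`_i \is symmetric by exact: char_poly_transfer_symmetric.
(* [P i] is the universal [c_i], the coefficient of [X^(2^d - i)] written in the elementary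
   symmetric polynomials. *)
pose P i := symf chi`_(2 ^ d - i).
have PE i : P i \mPo mesym_tuple d K = chi`_(2 ^ d - i) by rewrite -symfP.
pose lamY k := symf (mesym d K (d - k)).
have lamYE k : lamY k \mPo mesym_tuple d K = mesym d K (d - k).
  by rewrite -symfP ?mesym_sym.
pose v (j : 'I_d) := lam (d - j.+1)%N.
have lamYv k : (k <= d)%N -> (lamY k).@[v] = lam k by exact: meval_symf_mesym.
have t_n0 : t != 0 by rewrite -(t_const 1%N) ?t_neq0.
have p_rec_st n : (3 <= n)%N -> p n = ('X - s%:P) * p n.-1 - t%:P * p n.-2.
  by case: n => [|[|[|n]]] // _; rewrite (p_rec n.+3) // s_const // t_const.
(* The transfer principle: a relation valid for indeterminate roots holds at the given [lam]. *)
have meval0_eq (f : {mpoly K[d]}) : f \mPo mesym_tuple d K = 0 -> f.@[v] = 0.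
  by move=> /msym_fundamental_un0->; rewrite meval0.
exists (fun i => (P i).@[v]); split.
- have -> : P 0%N = 1; last by rewrite meval1.
  apply: msym_fundamental_un; rewrite PE comp_mpoly1 subn0.
  have /monicP := char_poly_monic
    (big_tensmx (fun l => transfer_mx ('X_l : {mpoly K[d]}) s%:MP t%:MP)).
  by rewrite /lead_coef size_char_poly.
- move=> n lt_n.
  (* [Hy] is a common source: it becomes [mesym_hankel] on substituting the elementary symmetric
     polynomials, and [H] at [v] for positive index. As [n > 2^d], every index [n - i] is
     positive. *)
  pose Hy m : {mpoly K[d]} := (\prod_(j < m) omega j)^-1%:MP *
    \det (\matrix_(i < m, j < m)
      \sum_(k < d.+1) lamY k * (moment L (i + j + k))%:MP).
  have HyE m : Hy m \mPo mesym_tuple d K = mesym_hankel L omega d m.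
    rewrite /Hy rmorphM /= comp_mpolyC -det_map_mx; congr (_ * \det _).
    apply/matrixP=> i j; rewrite !mxE rmorph_sum; apply: eq_bigr => k _.
    by rewrite rmorphM /= lamYE comp_mpolyC.
  have Hyv m : (0 < m)%N -> (Hy m).@[v] = H m.
    case: m => // m _; rewrite /H /scaled_hankel.
    rewrite (hankel_scaling mu0 p_orth p0E p1E p_rec t_const).
    rewrite /Hy rmorphM /= mevalC -det_map_mx; congr (_ * \det _).
    apply/matrixP=> i j; rewrite !mxE rmorph_sum; apply: eq_bigr => k _.
    by rewrite rmorphM /= lamYv ?mevalC // -ltnS.
  rewrite -[RHS](meval0_eq (\sum_(i < (2 ^ d).+1) P i * Hy (n - i)%N)).
    rewrite rmorph_sum; apply: eq_bigr => i _; rewrite rmorphM /= Hyv //.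
    by rewrite subn_gt0 (leq_ltn_trans _ lt_n) // -ltnS.
  rewrite rmorph_sum.
  rewrite -[RHS](mesym_hankel_recurrence p_monic p_size omega_neq0 p_orth p_rec_st
    d (n := n - 2 ^ d)); last by rewrite subn_gt0.
  rewrite (reindex_inj rev_ord_inj); apply: eq_bigr => i _ /=.
  have le_i : (i <= 2 ^ d)%N by rewrite -ltnS.
  rewrite rmorphM /= PE HyE subSS subKn //; congr (_ * mesym_hankel _ _ _ _).
  by rewrite subnBA // -addnBAC // ltnW.
- move=> Kbar iota _ x lamx.
  pose phi : {rmorphism {mpoly K[d]} -> Kbar} := mmap iota x.
  (* The hypothesis on [x] says that its elementary symmetric values are the images of [v]. *)
  have phiP i : phi chi`_(2 ^ d - i) = iota (P i).@[v].
    rewrite -PE; apply: mmap_comp_mesym => j.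
    by rewrite /v lamx ?leq_subr // subKn.
  have -> : char_poly (big_tensmx (fun i => transfer_mx (x i) (iota s) (iota t)))
      = map_poly phi chi.
    rewrite map_char_poly map_big_tensmx; congr char_poly.
    apply: eq_big_tensmx => l; rewrite map_transfer_mx /=.
    by rewrite /phi /= mmapX mmap1U !mmapC.
  rewrite -[RHS]coefK poly_def size_map_poly_id0; last first.
    by have /monicP-> := char_poly_monic
      (big_tensmx (fun l => transfer_mx ('X_l : {mpoly K[d]}) s%:MP t%:MP));
    rewrite rmorph1 oner_eq0.
  rewrite size_char_poly (reindex_inj rev_ord_inj); apply: eq_bigr => i _ /=.
  have le_i : (i <= 2 ^ d)%N by rewrite -ltnS.
  by rewrite subSS coef_map /= -phiP subKn.
- apply/eqP; rewrite -subr_eq0 opprK; apply/eqP.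
  rewrite -[RHS](meval0_eq (P 1%N + \sum_(j < d.+1) lamY j * (s ^+ j)%:MP)).
    rewrite rmorphD rmorph_sum; congr (_ + _); apply: eq_bigr => j _.
    by rewrite rmorphM /= lamYv ?mevalC // -ltnS.
  (* The universal [c_1] is minus the trace, that is minus the product of the ['X_l + s]; this
     product is the polynomial of [prod_XaddX] evaluated at [s]. *)
  rewrite rmorphD rmorph_sum /= PE subn1 /chi char_poly_trace ?expn_gt0 //.
  rewrite mxtrace_big_tensmx; apply/eqP; rewrite addrC subr_eq0; apply/eqP.
  have /(congr1 (horner^~ s%:MP)) := prod_XaddX K d.
  rewrite horner_prod horner_sum => horner_eq.
  transitivity (\prod_l ('X_l + s%:MP : {mpoly K[d]})); last first.
    by apply: eq_bigr => l _; rewrite mxtrace_transfer_mx.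
  transitivity (\prod_l ('X - (- ('X_l : {mpoly K[d]}))%:P).[s%:MP]); last first.
    by apply: eq_bigr => l _; rewrite hornerXsubC opprK addrC.
  rewrite horner_eq; apply: eq_bigr => j _.
  by rewrite rmorphM /= lamYE comp_mpolyC !hornerE /= -(rmorphXn (@mpolyC d K)).
- move=> i le_i.
  have palin : t ^+ (d * 2 ^ d.-1) * (P i).@[v] = t ^+ (d * i) * (P (2 ^ d - i)%N).@[v].
    apply/eqP; rewrite -subr_eq0; apply/eqP.
    rewrite -[RHS](meval0_eq ((t ^+ (d * 2 ^ d.-1))%:MP * P i
      - (t ^+ (d * i))%:MP * P (2 ^ d - i)%N)).
      by rewrite rmorphB !rmorphM /= !mevalC.
    rewrite rmorphB !rmorphM /= !comp_mpolyC !PE subKn // !(rmorphXn (@mpolyC d K)).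
    by rewrite char_poly_transfer_palindromic // subrr.
  (* The exponent [d (2^(d-1) - i)] may be negative, so both sides are compared after multiplication
     by [t^(di)]. *)
  apply: (mulfI (expf_neq0 (d * i) t_n0)); rewrite -palin mulrA; congr (_ * _).
  by rewrite !exprnP -expfzDr // !PoszM mulrBr addrC subrK.
Qed.
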